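(* Let $w$ be a Lévy white noise with Lévy exponent $f$ such that $X_{\mathrm{rect}} = \langle \mathrm{rect}_{[0,1]}, w\rangle$ has zero mean and finite variance $\sigma_w^2 = \mathbb{E}[X_{\mathrm{rect}}^2]$. Let $n \in \mathbb{N}$, $n\ge 1$, and let $w_n$ be the compound-Poisson innovation approximating $w$, that is, $$w_n = \sum_{k\in\mathbb{Z}} A_{k,n}\,\delta(\cdot - \tau_{k,n}),$$ with impulse locations $\tau_{k,n}$ of rate $\lambda_n = n$ and i.i.d. infinitely divisible amplitudes $A_{k,n}$ with Lévy exponent $f_n = \frac1n f$. Set $X_{\mathrm{rect},n} = \langle \mathrm{rect}_{[0,1]}, w_n\rangle$. Then $$\mathbb{E}[X_{\mathrm{rect},n}] = \mathbb{E}[X_{\mathrm{rect}}] = 0$$ and $$\sigma_{w_n}^2 := \mathbb{E}[X_{\mathrm{rect},n}^2] = \mathbb{E}[X_{\mathrm{rect}}^2] = \sigma_w^2 .$$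
   Context: $\mathcal{S}(\mathbb{R})$ is the Schwartz space and $\mathcal{S}'(\mathbb{R})$ the space of tempered distributions. A generalized stochastic process is a random element of $\mathcal{S}'(\mathbb{R})$. A real random variable $X$ is infinitely divisible if for every $M\ge 1$ it can be written (in law) as a sum of $M$ i.i.d. random variables. Its Lévy exponent is the continuous function $f:\mathbb{R}\to\mathbb{C}$ with $f(0)=0$ and $\mathbb{E}[e^{\mathrm{j}\xi X}] = e^{f(\xi)}$, where $\mathrm{j}$ is the imaginary unit. A Lévy white noise $w$ with Lévy exponent $f$ is a generalized stochastic process that is stationary, has independent values on test functions with disjoint supports, and satisfies, for all $\varphi\in\mathcal{S}(\mathbb{R})$ and $\xi\in\mathbb{R}$, $$\mathbb{E}[e^{\mathrm{j}\xi\langle\varphi,w\rangle}] = \exp\Big(\int_{\mathbb{R}} f(\xi\varphi(r))\,\mathrm{d}r\Big).$$ The function $\mathrm{rect}_{[0,1]}$ equals $1$ for $0<x\le 1$ and $0$ otherwise. Although it is not in $\mathcal{S}(\mathbb{R})$, the random variable $X_{\mathrm{rect}}=\langle \mathrm{rect}_{[0,1]},w\rangle$ is well defined by extension. It is infinitely divisible with Lévy exponent $f$, i.e. $\mathbb{E}[e^{\mathrm{j}\xi X_{\mathrm{rect}}}] = e^{f(\xi)}$. Compound-Poisson innovation of rate $\lambda$: the random measure $\sum_{k\in\mathbb{Z}} A_k\delta(\cdot-\tau_k)$, where $(\tau_k)$ are the points of a homogeneous Poisson point process on $\mathbb{R}$ of rate $\lambda$ (the number of points in $[a,b]$ is Poisson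 with parameter $\lambda(b-a)$) and $(A_k)$ is an i.i.d. sequence independent of the locations. In particular $\langle \mathrm{rect}_{[0,1]}, \sum_k A_k\delta(\cdot-\tau_k)\rangle=\sum_{k:\,\tau_k\in(0,1]}A_k$ is a compound-Poisson random variable: a sum of $K$ i.i.d. amplitudes, with $K$ a Poisson variable of parameter $\lambda$ independent of the amplitudes. *)

(* Defs.v *)
(* MathComp-Analysis, with the complex numbers R[i] of real-closed. *)
From HB Require Import structures.
From mathcomp Require Import all_boot all_order all_algebra.
From mathcomp Require Import all_classical all_reals all_analysis.
From mathcomp.real_closed Require Import complex.

Set Implicit Arguments.
Unset Strict Implicit.
Unset Printing Implicit Defensive.

Import Order.TTheory GRing.Theory Num.Theory.
Import numFieldNormedType.Exports.

Local Open Scope classical_set_scope.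
Local Open Scope ring_scope.
Local Open Scope complex_scope.

Definition cexp (R : realType) (z : R[i]) : R[i] :=
  (expR (complex.Re z))%:C
  * (cos (complex.Im z) +i* sin (complex.Im z)).

Definition cintegrable d (T : measurableType d) (R : realType)
    (mu : {measure set T -> \bar R}) (g : T -> R[i]) : Prop :=
  mu.-integrable setT (EFin \o (fun x => complex.Re (g x))) /\
  mu.-integrable setT (EFin \o (fun x => complex.Im (g x))).

Definition cintegral d (T : measurableType d) (R : realType)
    (mu : {measure set T -> \bar R}) (g : T -> R[i]) : R[i] :=
  Rintegral mu setT (fun x => complex.Re (g x))
  +i* Rintegral mu setT (fun x => complex.Im (g x)).

Definition char_fun d (T : measurableType d) (R : realType)
    (P : probability T R) (X : T -> R) (xi : R) : R[i] :=
  cintegral P (fun t => cexp (0 +i* (xi * X t))).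

Section independence.
Context d (T : measurableType d) (R : realType) (P : probability T R).

Definition mutually_independent (I : choiceType) (X : I -> T -> R) : Prop :=
  forall (s : seq I) (B : I -> set R),
    uniq s -> (forall i, measurable (B i)) ->
    P (\bigcap_(i in [set` s]) (X i @^-1` B i))
    = (\prod_(i <- s) P (X i @^-1` B i))%E.

Definition independent (X Y : T -> R) : Prop :=
  forall B C : set R, measurable B -> measurable C ->
    P (X @^-1` B `&` Y @^-1` C) = (P (X @^-1` B) * P (Y @^-1` C))%E.

Definition sigma_of (I : Type) (X : I -> T -> R) : set_system T :=
  <<s [set E | exists i, exists2 B : set R, measurable B & E = X i @^-1` B] >>.

Definition independent_families (I J : Type)
    (X : I -> T -> R) (Y : J -> T -> R) : Prop :=
  forall E F, sigma_of X E -> sigma_of Y F -> P (E `&` F) = (P E * P F)%E.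

Definition identically_distributed (I : Type) (X : I -> T -> R) : Prop :=
  forall i j (B : set R), measurable B -> P (X i @^-1` B) = P (X j @^-1` B).

Definition iid (I : choiceType) (X : I -> T -> R) : Prop :=
  mutually_independent X /\ identically_distributed X.

Definition cvg_in_probability (Y : nat -> T -> R) (X : T -> R) : Prop :=
  forall e : R, 0 < e ->
    P [set t | e <= `|Y m t - X t|] @[m --> \oo] --> 0%E.

End independence.

Definition infinitely_divisible d (T : measurableType d) (R : realType)
    (P : probability T R) (X : T -> R) : Prop :=
  forall M : nat, (0 < M)%N ->
    exists (d' : measure_display) (T' : measurableType d')
      (P' : probability T' R) (Y : 'I_M -> {RV P' >-> R}),
      iid P' (fun i => Y i : T' -> R) /\
      forall B : set R, measurable B ->
        P (X @^-1` B) = P' ((fun t => \sum_(i < M) Y i t) @^-1` B).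

Definition has_levy_exponent d (T : measurableType d) (R : realType)
    (P : probability T R) (X : T -> R) (f : R -> R[i]) : Prop :=
  [/\ infinitely_divisible P X,
      continuous (f : R -> R[i]^o),
      f 0 = 0 &
      forall xi, char_fun P X xi = cexp (f xi)].

Definition levy_exponent (R : realType) (f : R -> R[i]) : Prop :=
  exists (d : measure_display) (T : measurableType d)
    (P : probability T R) (X : {RV P >-> R}), has_levy_exponent P X f.

Section tempered.
Context {R : realType}.

Definition schwartz : set (R -> R) :=
  [set phi | (forall k (x : R), derivable (derive1n k phi) x 1) /\
    forall m k, exists C : R, forall x : R,
      `|x| ^+ m * `|derive1n k phi x| <= C].

Definition schwartz_cvg (phi_ : nat -> R -> R) (phi : R -> R) : Prop :=
  forall m k (e : R), 0 < e ->
    \forall j \near \oo, forall x : R,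
      `|x| ^+ m * `|derive1n k (phi_ j \- phi) x| <= e.

(* Functionals are total on R -> R, and only their values on Schwartz
   functions are meaningful.  Since the topology of the Schwartz space is
   metrizable, continuity is sequential continuity. *)
Definition tempered (u : (R -> R) -> R) : Prop :=
  (forall (a : R) phi psi, schwartz phi -> schwartz psi ->
     u (fun x => a * phi x + psi x) = a * u phi + u psi) /\
  (forall phi_ phi, (forall j, schwartz (phi_ j)) -> schwartz phi ->
     schwartz_cvg phi_ phi -> u (phi_ j) @[j --> \oo] --> u phi).

(* The cylinder sigma-algebra; on tempered distributions it coincides with the
   Borel sigma-algebra. *)
Definition cylinder : set_system ((R -> R) -> R) :=
  <<s [set C | exists2 phi, schwartz phi &
         exists2 B : set R, measurable B & C = [set u | B (u phi)]] >>.

Definition translate (r : R) (u : (R -> R) -> R) : (R -> R) -> R :=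
  fun phi => u (fun x => phi (x + r)).

Definition closed_support (phi : R -> R) : set R :=
  closure [set x | phi x != 0].

End tempered.

Section levy_white_noise.
Context d (T : measurableType d) (R : realType) (P : probability T R).
Implicit Types w : T -> (R -> R) -> R.

Definition generalized_process w : Prop :=
  (forall t, tempered (w t)) /\
  (forall C, cylinder C -> measurable (w @^-1` C)).

Definition stationary w : Prop :=
  forall (r : R) C, cylinder C ->
    P ((fun t => translate r (w t)) @^-1` C) = P (w @^-1` C).

Definition independent_values w : Prop :=
  forall phi psi, schwartz phi -> schwartz psi ->
    closed_support phi `&` closed_support psi = set0 ->
    independent P (w^~ phi) (w^~ psi).

Definition levy_white_noise w (f : R -> R[i]) : Prop :=
  [/\ levy_exponent f, generalized_process w, stationary w,
      independent_values w &
      forall phi xi, schwartz phi ->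
        cintegrable (@lebesgue_measure R) (fun r => f (xi * phi r)) /\
        char_fun P (w^~ phi) xi
        = cexp (cintegral (@lebesgue_measure R) (fun r => f (xi * phi r)))].

(* X is <g, w> for a bounded g of bounded support: it is a limit in
   probability of <phi_m, w>, for Schwartz functions phi_m that tend to g
   almost everywhere and are bounded, with bounded support, uniformly in m.
   By the formula for the characteristic functional, up to almost sure
   equality the limit does not depend on the sequence. *)
Definition extended_pairing w (g : R -> R) (X : T -> R) : Prop :=
  exists phi_ : nat -> R -> R,
    [/\ forall m, schwartz (phi_ m),
        exists K : R, forall m (x : R), `|phi_ m x| <= K,
        exists K : R, forall m (x : R), K < `|x| -> phi_ m x = 0,
        {ae @lebesgue_measure R, forall x : R, phi_ m x @[m --> \oo] --> g x} &
        cvg_in_probability P (fun m => w^~ (phi_ m)) X].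

End levy_white_noise.

Definition rect01 (R : realType) : R -> R := \1_`]0, 1].

Section compound_poisson.
Context d (T : measurableType d) (R : realType) (P : probability T R).

Definition num_points (tau : int -> T -> R) (B : set R) (t : T) : \bar R :=
  (\esum_(k in [set: int]) \d_(tau k t) B)%E.

Definition poisson_process (lambda : R) (tau : int -> T -> R) : Prop :=
  (forall (a b : R) (j : nat), a < b ->
     P [set t | num_points tau `[a, b] t = j%:R%:E]
     = (poisson_pmf (lambda * (b - a)) j)%:E) /\
  (forall (m : nat) (B : 'I_m -> set R) (j : 'I_m -> nat),
     (forall i, measurable (B i)) -> trivIset setT B ->
     P (\bigcap_i [set t | num_points tau (B i) t = (j i)%:R%:E])
     = (\prod_(i < m) P [set t | num_points tau (B i) t = (j i)%:R%:E])%E).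

Definition compound_poisson_innovation (lambda : R) (f : R -> R[i])
    (A tau : int -> {RV P >-> R}) : Prop :=
  [/\ poisson_process lambda (fun k => tau k : T -> R),
      iid P (fun k => A k : T -> R),
      forall k, has_levy_exponent P (A k) f &
      independent_families P (fun k => A k : T -> R)
                             (fun k => tau k : T -> R)].

(* The measure \sum_k A_k delta_(tau_k) applied to g.  When g has bounded
   support, almost surely finitely many terms are nonzero; a sum with
   infinitely many nonzero terms is 0 by convention. *)
Definition innovation (A tau : int -> T -> R) (t : T) (g : R -> R) : R :=
  \sum_(k \in [set: int]) (A k t * g (tau k t)).

End compound_poisson.

(* Main.v *)
Require Import Defs.
From HB Require Import structures.
From mathcomp Require Import all_boot all_order all_algebra.
From mathcomp Require Import all_classical all_reals all_analysis.
From mathcomp.real_closed Require Import complex.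
From mathcomp Require Import ring lra.
From mathcomp Require Import measurable_realfun.

(** Mean and variance of a random variable can be read off its
characteristic function near [0]: along any sequence [h m --> 0],
[E[sin(h X)] / h] tends to [E[X]] and [2 (1 - E[cos(h X)]) / h^2] tends to
[E[X^2]]; conversely, by Fatou's lemma, convergence of the latter forces
[E[X^2]] to be finite ([mean_of_char_fun], [second_moment_of_char_fun],
[square_integrable_of_char_fun]).

The characteristic function of the rectangle observation is [exp f]: test
functions approximating the rectangle give [exp (int f(xi phi_m))], and both
sides pass to the limit, by convergence in probability on one side and by
dominated convergence on the other ([char_fun_extended_pairing]).  The
amplitudes have characteristic function [exp (f / n)].  Finite variance and
zero mean say that [Re f] behaves like [- sigma^2 h^2 / 2] and that [Im f] is
[o(h)]; both properties are homogeneous in [f], so the amplitudes are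
centered with second moment [sigma^2 / n] ([levy_scaling],
[moments_scale_char_fun]).

For the compound-Poisson sum, let [F m] be the event that the m-th impulse
falls in the unit interval.  The Poisson law gives [sum_m P(F m) = n]
([poisson_intensity_rect01]), so by the Borel-Cantelli lemma almost surely
only finitely many [F m] occur.  The sample space splits, up to a null set,
into countably many events [H M] of the sigma-algebra of the locations on which
only the first [M] impulses can contribute.  On each of them the sum is finite,
amplitudes are independent of the event, and distinct amplitudes are
uncorrelated; hence the mean over [H M] vanishes and the integral of the square
is [sigma^2 / n] times [sum_m P(H M & F m)].  Summing over [M] gives
[sigma^2 / n * n] ([random_sum_mean], [random_sum_second_moment]). *)

Set Implicit Arguments.
Unset Strict Implicit.
Unset Printing Implicit Defensive.

Import Order.TTheory GRing.Theory Num.Theory.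
Import numFieldNormedType.Exports.

Local Open Scope classical_set_scope.
Local Open Scope ring_scope.
Local Open Scope complex_scope.

(** * Second-order expansion of Levy exponents at the origin *)

Section tangent.
Context {R : realType}.
Implicit Types (L c : R).

(** A function with slope [1] at the origin is [x * q x] with [q] tending to
[1]: the form of the derivative that allows both multiplying and dividing inside
limits. *)
Lemma tangent_factor (g : R -> R) : g 0 = 0 -> is_derive (0 : R) (1 : R) g 1 ->
  exists2 q : R -> R, forall x, g x = q x * x &
    forall x : nat -> R, x m @[m --> \oo] --> (0 : R) -> q (x m) @[m --> \oo] --> (1 : R).
Proof.
move=> g0 /is_derive1_caratheodory[q [qE qc q0]].
exists q => [x|x x0]; first by have := qE x; rewrite g0 !subr0.
rewrite -q0.
exact: (@continuous_cvg _ _ _ _ _ x q _ qc x0).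
Qed.

Lemma is_derive_sin0 : is_derive (0 : R) (1 : R) (@sin R) 1.
Proof. by have := is_derive_sin (0 : R); rewrite cos0. Qed.

Lemma is_derive_expRB1 : is_derive (0 : R) (1 : R) (fun x : R => expR x - 1) 1.
Proof.
apply: is_derive_eq.
by rewrite subr0 expR0.
Qed.

Lemma onem_cosE (x : R) : 1 - cos x = 2 * sin (x / 2) ^+ 2.
Proof.
have {1}-> : x = (x / 2) *+ 2 by rewrite -mulr_natr divfK.
by rewrite cos_mulr2n cos2sin2; lra.
Qed.

Lemma sin_small (b h : nat -> R) : b m @[m --> \oo] --> (0 : R) ->
  b m / h m @[m --> \oo] --> (0 : R) -> sin (b m) / h m @[m --> \oo] --> (0 : R).
Proof.
move=> b0 bh; have [q qE q1] := tangent_factor (@sin0 R) is_derive_sin0.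
rewrite -(mulr0 1).
under eq_cvg do rewrite qE -mulrA.
by apply: cvgM => //; exact: q1.
Qed.

Lemma onem_cos_small (b h : nat -> R) : b m @[m --> \oo] --> (0 : R) ->
  b m / h m @[m --> \oo] --> (0 : R) ->
  (1 - cos (b m)) / h m ^+ 2 @[m --> \oo] --> (0 : R).
Proof.
move=> b0 bh.
have s : sin (b m / 2) / h m @[m --> \oo] --> (0 : R).
  apply: sin_small; first by rewrite -(mul0r 2^-1); exact: cvgMl.
  rewrite -(mul0r 2^-1); under eq_cvg do rewrite mulrAC; exact: cvgMl.
rewrite -(mulr0 2) -(mulr0 0).
under eq_cvg do rewrite onem_cosE -mulrA -exprVn -exprMn expr2.
by apply: cvgMr; exact: cvgM.
Qed.

(** When [b = o(h)], the cosine contributes only [o(h^2)], and the real part of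
[exp (a + i b)] has a second-order expansion exactly when [a] has one. *)
Lemma expR_cos_expansion (a b h : nat -> R) L :
  (forall m, h m != 0) ->
  a m @[m --> \oo] --> (0 : R) -> b m @[m --> \oo] --> (0 : R) ->
  b m / h m @[m --> \oo] --> (0 : R) ->
  (a m / h m ^+ 2 @[m --> \oo] --> - L) <->
  ((1 - expR (a m) * cos (b m)) / h m ^+ 2 @[m --> \oo] --> L).
Proof.
move=> h0 a0 b0 bh.
have eB0 : expR (0 : R) - 1 = 0 by rewrite expR0 subrr.
have [q qE q1] := @tangent_factor (fun x => expR x - 1) eB0 is_derive_expRB1.
have c1 : cos (b m) @[m --> \oo] --> (1 : R).
  rewrite -(@cos0 R); apply: continuous_cvg => //; exact: continuous_cos.
have qc : q (a m) * cos (b m) @[m --> \oo] --> (1 : R).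
  rewrite -(mulr1 1); apply: cvgM => //; exact: q1.
have oc := onem_cos_small b0 bh.
have key m : (1 - expR (a m) * cos (b m)) / h m ^+ 2 =
   (1 - cos (b m)) / h m ^+ 2 - (q (a m) * cos (b m)) * (a m / h m ^+ 2).
  have := qE (a m); move/eqP; rewrite subr_eq => /eqP ->; field; exact: h0.
split => [aL|eL].
  rewrite -[L]opprK -[- - L]add0r -[- L]mul1r; under eq_cvg do rewrite key.
  by apply: cvgB => //; exact: cvgM.
have qn : \forall m \near \oo, q (a m) * cos (b m) != 0.
  exact: (cvgr_neq0 _ qc (oner_neq0 _)).
have lim : ((1 - cos (b m)) / h m ^+ 2 - (1 - expR (a m) * cos (b m)) / h m ^+ 2)
    / (q (a m) * cos (b m)) @[m --> \oo] --> (0 - L) / 1.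
  by apply: cvgM; [exact: cvgB|exact: cvgV].
rewrite divr1 sub0r in lim.
apply: cvg_trans lim; apply: near_eq_cvg; near=> m.
rewrite key opprB addrC subrK mulrC mulKf//.
by near: m.
Unshelve. all: by end_near. Qed.

(** The expansion of [exp (a + i b)] that expresses zero mean and second moment
[2 L] determines the expansion of [a] and makes [b] negligible.  These two
conditions are homogeneous in [(a, b)], so that they pass to the exponent
[c (a + i b)] and can be exponentiated back. *)
Lemma levy_scaling (a b h : nat -> R) L c :
  (forall m, h m != 0) ->
  a m @[m --> \oo] --> (0 : R) -> b m @[m --> \oo] --> (0 : R) ->
  expR (a m) * sin (b m) / h m @[m --> \oo] --> (0 : R) ->
  (1 - expR (a m) * cos (b m)) / h m ^+ 2 @[m --> \oo] --> L ->
  (expR (c * a m) * sin (c * b m) / h m @[m --> \oo] --> (0 : R)) /\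
  ((1 - expR (c * a m) * cos (c * b m)) / h m ^+ 2 @[m --> \oo] --> c * L).
Proof.
move=> h0 a0 b0 s1 s2.
have [q qE q1] := tangent_factor (@sin0 R) is_derive_sin0.
have e1 : expR (a m) @[m --> \oo] --> (1 : R).
  rewrite -(@expR0 R); apply: continuous_cvg => //; exact: continuous_expR.
have eq1 : expR (a m) * q (b m) @[m --> \oo] --> (1 : R).
  rewrite -(mulr1 1); apply: cvgM => //; exact: q1.
have bh : b m / h m @[m --> \oo] --> (0 : R).
  have lim : (expR (a m) * sin (b m) / h m) / (expR (a m) * q (b m)) @[m --> \oo] --> 0 / (1 : R).
    by apply: cvgM => //; exact: cvgV.
  rewrite mul0r in lim.
  apply: cvg_trans lim; apply: near_eq_cvg; near=> m.
  have qn : q (b m) != 0.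
    near: m; exact: (cvgr_neq0 _ (q1 _ b0) (oner_neq0 _)).
  rewrite qE; field; rewrite h0 qn/=; exact: lt0r_neq0 (expR_gt0 _).
have ca0 : c * a m @[m --> \oo] --> (0 : R) by rewrite -(mulr0 c); exact: cvgMr.
have cb0 : c * b m @[m --> \oo] --> (0 : R) by rewrite -(mulr0 c); exact: cvgMr.
have cbh : c * b m / h m @[m --> \oo] --> (0 : R).
  by rewrite -(mulr0 c); under eq_cvg do rewrite -mulrA; exact: cvgMr.
split.
  rewrite -(mulr0 1); under eq_cvg do rewrite -mulrA; apply: cvgM; last exact: sin_small.
  rewrite -(@expR0 R); apply: continuous_cvg => //; exact: continuous_expR.
apply/expR_cos_expansion => //.
rewrite -mulrN; under eq_cvg do rewrite -mulrA; apply: cvgMr.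
exact: (proj2 (expR_cos_expansion L h0 a0 b0 bh)).
Unshelve. all: by end_near. Qed.

End tangent.

(** * Moments from the characteristic function *)

Section trig_bounds.
Context {R : realType}.

Lemma nonexpansive_derive (g g' : R -> R) :
  (forall x, is_derive x (1 : R) g (g' x)) -> (forall x, `|g' x| <= 1) ->
  forall x y, `|g x - g y| <= `|x - y|.
Proof.
move=> gd g1.
have lt x y : x < y -> `|g y - g x| <= `|y - x|.
  move=> xy.
  have [|c _ ->] := @MVT R g g' x y xy (fun z _ => gd z).
    by apply: derivable_within_continuous => z _; have [] := gd z.
  by rewrite normrM ler_piMl.
move=> x y; case: (ltgtP x y) => [xy|xy|->]; last by rewrite !subrr.
- by rewrite distrC [leRHS]distrC; exact: lt.
- exact: lt.
Qed.

Lemma sin_nonexpansive (x y : R) : `|sin x - sin y| <= `|x - y|.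
Proof.
exact: (@nonexpansive_derive _ cos (@is_derive_sin R) (@cos_max R)).
Qed.

Lemma cos_nonexpansive (x y : R) : `|cos x - cos y| <= `|x - y|.
Proof.
apply: (@nonexpansive_derive _ (fun x => - sin x) (@is_derive_cos R)).
by move=> z; rewrite normrN sin_max.
Qed.

Lemma normr_sin_le (x : R) : `|sin x| <= `|x|.
Proof. by have := sin_nonexpansive x 0; rewrite sin0 !subr0. Qed.

Lemma onem_cos_ge0 (x : R) : 0 <= 1 - cos x.
Proof. by rewrite subr_ge0 cos_le1. Qed.

Lemma onem_cos_le (x : R) : 1 - cos x <= x ^+ 2 / 2.
Proof.
rewrite onem_cosE; have := normr_sin_le (x / 2).
rewrite -(@ler_pXn2r _ 2)// ?nnegrE// -!normrX !ger0_norm ?sqr_ge0//.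
by rewrite exprMn; lra.
Qed.

End trig_bounds.

Section char_fun_moments.
Context d (T : measurableType d) (R : realType).

Lemma cvg_Rintegral (mu : {measure set T -> \bar R})
    (f_ : nat -> T -> R) (f g : T -> R) :
  (forall m, measurable_fun setT (f_ m)) -> measurable_fun setT f ->
  {ae mu, forall x, f_ m x @[m --> \oo] --> f x} ->
  mu.-integrable setT (EFin \o g) -> (forall m x, `|f_ m x| <= g x) ->
  \int[mu]_x (f_ m x) @[m --> \oo] --> \int[mu]_x (f x).
Proof.
move=> mf_ mf f_f ig f_g.
have [|||||fi _] := @dominated_convergence _ _ _ mu setT measurableT
  (fun m => EFin \o f_ m) (EFin \o f) (EFin \o g).
- by move=> m; apply/measurable_EFinP.
- exact/measurable_EFinP.
- move: f_f; apply: filterS => x f_f _.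
  by apply: cvg_EFin f_f; exact: nearW.
- exact: ig.
- by apply: aeW => x m _ /=; rewrite lee_fin.
rewrite /Rintegral => cv; apply: fine_cvg; rewrite fineK//.
exact: integrable_fin_num.
Qed.

Variable P : probability T R.
Implicit Type X : T -> R.

Lemma integrable_bounded X (K : R) : measurable_fun setT X ->
  (forall x, `|X x| <= K) -> P.-integrable setT (EFin \o X).
Proof.
move=> mX XK; apply: measurable_bounded_integrable => //.
  by rewrite (le_lt_trans (probability_le1 P _))// ltry.
exists K; split; first exact: num_real.
by move=> M KM x _; apply: le_trans (XK x) (ltW KM).
Qed.

Lemma measurable_cosM X (c : R) : measurable_fun setT X ->
  measurable_fun setT (fun t => cos (c * X t)).
Proof.
move=> mX; apply: measurableT_comp; last exact: measurable_funM.
by apply: continuous_measurable_fun; exact: continuous_cos.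
Qed.

Lemma measurable_sinM X (c : R) : measurable_fun setT X ->
  measurable_fun setT (fun t => sin (c * X t)).
Proof.
move=> mX; apply: measurableT_comp; last exact: measurable_funM.
by apply: continuous_measurable_fun; exact: continuous_sin.
Qed.

Variable h : nat -> R.
Hypothesis h_neq0 : forall m, h m != 0.
Hypothesis h_cvg0 : h m @[m --> \oo] --> (0 : R).

Lemma sin_quotient_cvg (x : R) : sin (h m * x) / h m @[m --> \oo] --> x.
Proof.
have [q qE q1] := tangent_factor (@sin0 R) is_derive_sin0.
rewrite -[X in _ --> X]mul1r.
have E m : sin (h m * x) / h m = q (h m * x) * x.
  by rewrite qE; field; exact: h_neq0.
under eq_cvg do rewrite E.
apply: cvgMl; apply: q1; rewrite -(mul0r x); exact: cvgMl.
Qed.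

Lemma onem_cos_quotient_cvg (x : R) :
  2 * (1 - cos (h m * x)) / h m ^+ 2 @[m --> \oo] --> x ^+ 2.
Proof.
have s := @sin_quotient_cvg (x / 2).
have E m : 2 * (1 - cos (h m * x)) / h m ^+ 2 =
   (2 * (sin (h m * (x / 2)) / h m)) * (2 * (sin (h m * (x / 2)) / h m)).
  by rewrite onem_cosE -(mulrA (h m)); field; exact: h_neq0.
under eq_cvg do rewrite E.
have -> : x ^+ 2 = (2 * (x / 2)) * (2 * (x / 2)) by field.
by apply: cvgM; exact: cvgMr.
Qed.

Lemma mean_of_char_fun X : measurable_fun setT X ->
  P.-integrable setT (EFin \o X) ->
  (\int[P]_t sin (h m * X t)) / h m @[m --> \oo] --> \int[P]_t X t.
Proof.
move=> mX iX.
have E m : (\int[P]_t sin (h m * X t)) / h m = \int[P]_t (sin (h m * X t) / h m).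
  rewrite RintegralZr//; apply: (@integrable_bounded _ 1).
    exact: measurable_sinM.
  by move=> x; exact: sin_max.
under eq_cvg do rewrite E.
apply: (@cvg_Rintegral P _ X (fun t => `|X t|)) => //.
- by move=> m; apply: measurable_funM => //; exact: measurable_sinM.
- by apply: aeW => x; exact: sin_quotient_cvg.
- by have /= := integrable_abse iX.
move=> m x; rewrite normrM normfV ler_pdivrMr ?normr_gt0//.
by rewrite mulrC -normrM; exact: normr_sin_le.
Qed.

Lemma RintegralE_onem_cos X : measurable_fun setT X -> forall m,
  2 * (1 - \int[P]_t cos (h m * X t)) / h m ^+ 2
  = \int[P]_t (2 * (1 - cos (h m * X t)) / h m ^+ 2).
Proof.
move=> mX m.
have ic : P.-integrable setT (EFin \o (fun t => cos (h m * X t))).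
  apply: (@integrable_bounded _ 1); first exact: measurable_cosM.
  by move=> x; exact: cos_max.
have i1 : P.-integrable setT (EFin \o (fun=> 1)).
  by apply: (@integrable_bounded _ 1) => // x; rewrite normr1.
have iB : P.-integrable setT (EFin \o (fun t => 1 - cos (h m * X t))).
  by have := integrableB measurableT i1 ic.
have i2 : P.-integrable setT (EFin \o (fun t => 2 * (1 - cos (h m * X t)))).
  by have := integrableZl measurableT 2 iB.
rewrite RintegralZr// RintegralZl// RintegralB//.
by rewrite Rintegral_cst//= [P setT]probability_setT mulr1.
Qed.

Lemma measurable_onem_cos_quotient X m : measurable_fun setT X ->
  measurable_fun setT (fun t => 2 * (1 - cos (h m * X t)) / h m ^+ 2).
Proof.
move=> mX; apply: measurable_funM => //; apply: measurable_funM => //.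
by apply: measurable_funB => //; exact: measurable_cosM.
Qed.

(** Dominated convergence, with [X^2] as the dominating function. *)
Lemma second_moment_of_char_fun X : measurable_fun setT X ->
  P.-integrable setT (EFin \o (fun t => X t ^+ 2)) ->
  2 * (1 - \int[P]_t cos (h m * X t)) / h m ^+ 2
    @[m --> \oo] --> \int[P]_t (X t ^+ 2).
Proof.
move=> mX iX; under eq_cvg do rewrite RintegralE_onem_cos//.
apply: (@cvg_Rintegral P _ _ (fun t => X t ^+ 2)) => //.
- by move=> m; exact: measurable_onem_cos_quotient.
- exact: measurable_funX.
- by apply: aeW => x; exact: onem_cos_quotient_cvg.
move=> m x; rewrite ger0_norm; last first.
  by rewrite divr_ge0 ?sqr_ge0// mulr_ge0// onem_cos_ge0.
rewrite ler_pdivrMr; last by rewrite exprn_even_gt0//= h_neq0.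
by have := onem_cos_le (h m * X x); rewrite exprMn; lra.
Qed.

(** The integrands [2 (1 - cos(h X)) / h^2] are nonnegative and tend to [X^2], so
Fatou's lemma bounds [E[X^2]] by the limit of their integrals. *)
Lemma square_integrable_of_char_fun X (L : R) : measurable_fun setT X ->
  2 * (1 - \int[P]_t cos (h m * X t)) / h m ^+ 2 @[m --> \oo] --> L ->
  P.-integrable setT (EFin \o (fun t => X t ^+ 2)).
Proof.
move=> mX cL.
have mX2 : measurable_fun setT (EFin \o (fun t => X t ^+ 2)).
  by apply/measurable_EFinP; exact: measurable_funX.
apply/integrableP; split => //.
under eq_integral do rewrite /= ger0_norm ?sqr_ge0//.
have := @fatou _ _ _ P setT measurableT
  (fun m t => (2 * (1 - cos (h m * X t)) / h m ^+ 2)%:E).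
have -> : (fun x => limn_einf (fun m =>
    (2 * (1 - cos (h m * X x)) / h m ^+ 2)%:E)) = EFin \o (fun t => X t ^+ 2).
  apply/funext => x.
  have c : (2 * (1 - cos (h m * X x)) / h m ^+ 2)%:E
      @[m --> \oo] --> (X x ^+ 2)%:E.
    by apply: cvg_EFin; [exact: nearW|exact: onem_cos_quotient_cvg].
  by rewrite (cvg_limn_einf_sup c).1.
have c2 : (\int[P]_t (2 * (1 - cos (h m * X t)) / h m ^+ 2)%:E)%E
    @[m --> \oo] --> L%:E.
  have E m : (\int[P]_t (2 * (1 - cos (h m * X t)) / h m ^+ 2)%:E)%E =
     (2 * (1 - \int[P]_t cos (h m * X t)) / h m ^+ 2)%:E.
    rewrite RintegralE_onem_cos// /Rintegral fineK//.
    apply: integrable_fin_num => //.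
    apply: (@integrable_bounded _ (4 / h m ^+ 2)).
      exact: measurable_onem_cos_quotient.
    move=> x; rewrite normrM normfV [`|h m ^+ 2|]ger0_norm ?sqr_ge0//.
    rewrite ler_pM2r; last by rewrite invr_gt0 exprn_even_gt0//= h_neq0.
    by rewrite ger0_norm ?mulr_ge0 ?onem_cos_ge0//; have := cos_geN1 (h m * X x); lra.
  by under eq_cvg do rewrite E; apply: cvg_EFin => //; exact: nearW.
rewrite (cvg_limn_einf_sup c2).1 => F.
apply: le_lt_trans (ltry L); apply: F.
  by move=> m; apply/measurable_EFinP; exact: measurable_onem_cos_quotient.
by move=> m x _; rewrite lee_fin divr_ge0 ?sqr_ge0// mulr_ge0// onem_cos_ge0.
Qed.

End char_fun_moments.

(** * Characteristic function of the rectangle observation *)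

Section complex_parts.
Context {R : realType}.

Lemma cvg_continuous_comp (g : R -> R) (u : nat -> R) (l : R) : continuous g ->
  u m @[m --> \oo] --> l -> g (u m) @[m --> \oo] --> g l.
Proof. by move=> cg ul; apply: continuous_cvg => //; exact: cg. Qed.

Lemma continuous_Re (f : R -> R[i]) : continuous (f : R -> R[i]^o) ->
  continuous (fun x => complex.Re (f x)).
Proof.
move=> cf x; apply/cvgrPdist_lt => e e0.
have e0C : (0 : R[i]) < e%:C by rewrite (ltcR 0 e).
have fx := proj1 (cvgrPdist_lt _ _) (cf x) _ e0C.
near=> t.
have fxt : `|f x - f t| < e%:C by near: t; exact: fx.
rewrite -ltcR; apply: le_lt_trans fxt.
have -> : complex.Re (f x) - complex.Re (f t) = complex.Re (f x - f t).
  by case: (f x) (f t) => [a b] [a' b'].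
exact: normc_ge_Re.
Unshelve. all: by end_near. Qed.

Lemma continuous_Im (f : R -> R[i]) : continuous (f : R -> R[i]^o) ->
  continuous (fun x => complex.Im (f x)).
Proof.
move=> cf x; apply/cvgrPdist_lt => e e0.
have e0C : (0 : R[i]) < e%:C by rewrite (ltcR 0 e).
have fx := proj1 (cvgrPdist_lt _ _) (cf x) _ e0C.
near=> t.
have fxt : `|f x - f t| < e%:C by near: t; exact: fx.
rewrite -ltcR; apply: le_lt_trans fxt.
have -> : complex.Im (f x) - complex.Im (f t) = complex.Im (f x - f t).
  by case: (f x) (f t) => [a b] [a' b'].
rewrite normc_def lecR -sqrtr_sqr ler_wsqrtr// lerDr; exact: sqr_ge0.
Unshelve. all: by end_near. Qed.

Lemma cexp_ReIm (z : R[i]) : cexp z =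
  (expR (complex.Re z) * cos (complex.Im z))
  +i* (expR (complex.Re z) * sin (complex.Im z)).
Proof. by rewrite /cexp; simpc. Qed.

Lemma char_funE d (T : measurableType d) (P : probability T R) (X : T -> R) xi :
  char_fun P X xi = (\int[P]_t cos (xi * X t)) +i* (\int[P]_t sin (xi * X t)).
Proof.
rewrite /char_fun /cintegral; congr (_ +i* _); apply: eq_Rintegral => t _;
  by rewrite cexp_ReIm/= expR0 mul1r.
Qed.

End complex_parts.

Section white_noise_char_fun.
Context d (T : measurableType d) (R : realType) (P : probability T R).

(** The difference of the integrands is at most [|xi| c] where [|Y m - X| < c] and
at most [2] elsewhere, on an event of vanishing probability. *)
Lemma cvg_in_probability_Rintegral (g : R -> R) (Y : nat -> T -> R) (X : T -> R) :
  continuous g -> (forall x y, `|g x - g y| <= `|x - y|) ->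
  (forall x, `|g x| <= 1) ->
  (forall m, measurable_fun setT (Y m)) -> measurable_fun setT X ->
  cvg_in_probability P Y X -> forall xi : R,
  \int[P]_t g (xi * Y m t) @[m --> \oo] --> \int[P]_t g (xi * X t).
Proof.
move=> cg lg bg mY mX YX xi.
have mgM (Z : T -> R) : measurable_fun setT Z -> measurable_fun setT (fun t => g (xi * Z t)).
  move=> mZ; have mZ' : measurable_fun setT (fun t => xi * Z t) by exact: measurable_funM.
  exact: (measurableT_comp (continuous_measurable_fun cg) mZ').
have iM (Z : T -> R) : measurable_fun setT Z ->
    P.-integrable setT (EFin \o (fun t => g (xi * Z t))).
  by move=> mZ; apply: (@integrable_bounded _ _ _ P _ 1) => //; exact: mgM.
apply/cvgrPdist_le => e e0.
(* The constants make [|xi| c <= e / 2] and [2 P(D) < e / 2]. *)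
pose c := e / (2 * (`|xi| + 1)).
have c0 : 0 < c by rewrite divr_gt0// mulr_gt0// ltr_wpDl.
have e4 : (0 : R) < e / 4 by rewrite divr_gt0.
have /fine_cvgP[_] := YX c c0.
move=> /cvgrPdist_lt /(_ _ e4); apply: filterS => m.
set D := [set t | c <= `|Y m t - X t|].
have mD : measurable D.
  have -> : D = (fun t => `|Y m t - X t|) @^-1` `[c, +oo[.
    by apply/seteqP; split => t /=; rewrite in_itv/= andbT.
  rewrite -[X in measurable X]setTI.
  have mYX : measurable_fun setT (fun t => `|Y m t - X t|).
    by apply: measurableT_comp => //; exact: measurable_funB.
  by apply: mYX => //; exact: measurable_itv.
rewrite /= sub0r normrN ger0_norm ?fine_ge0// => PD.
rewrite -RintegralB//; try exact: iM.
have iB := integrableB measurableT (iM _ mX) (iM _ (mY m)).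
apply: le_trans (le_normr_Rintegral measurableT iB) _.
have iD : P.-integrable setT (EFin \o (fun t => 2 * \1_D t)).
  apply: (@integrable_bounded _ _ _ P _ 2).
    by apply: measurable_funM => //; exact: measurable_indic.
  by move=> x; rewrite normrM ger0_norm// ler_piMr// indicE normr_nat lern1 leq_b1.
have iD1 : P.-integrable setT (EFin \o \1_D).
  apply: (@integrable_bounded _ _ _ P _ 1); first exact: measurable_indic.
  by move=> x; rewrite indicE normr_nat lern1 leq_b1.
have ic : P.-integrable setT (EFin \o (fun=> `|xi| * c)).
  apply: (@integrable_bounded _ _ _ P _ (`|xi| * c)) => // x.
  by rewrite ger0_norm// mulr_ge0// ltW.
apply: (@le_trans _ _ (\int[P]_t (`|xi| * c + 2 * \1_D t))).
  apply: le_Rintegral => //.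
  - by have := integrable_abse iB.
  - by have := integrableD measurableT ic iD.
  move=> t _ /=; rewrite indicE; have [tD|/negP tD] := boolP (t \in D).
    rewrite mulr1 (le_trans (ler_normB _ _))//.
    rewrite -[leLHS]add0r lerD//; first by rewrite mulr_ge0// ltW.
    by have := bg (xi * X t); have := bg (xi * Y m t); lra.
  rewrite mulr0 addr0 (le_trans (lg _ _))// -mulrBr normrM ler_wpM2l//.
  rewrite distrC ltW// ltNge; apply/negP => tD'.
  by apply: tD; rewrite inE.
rewrite RintegralD// Rintegral_cst//= RintegralZl// [P setT]probability_setT mulr1.
rewrite /Rintegral integral_indic// setIT.
have : `|xi| * c <= e / 2.
  rewrite /c mulrA ler_pdivrMr ?mulr_gt0 ?ltr_wpDl//.
  rewrite mulrC -mulrA ler_wpM2l ?ltW//; lra.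
lra.
Qed.

(** Since [u 0 = 0], the integrands vanish outside a common bounded interval, on
which they are bounded uniformly in [m] because [u] is bounded on a compact
interval; dominated convergence applies. *)
Lemma rect01_Rintegral_limit (phi_ : nat -> R -> R) (K K' : R)
    (u : R -> R) (xi : R) :
  continuous u -> u 0 = 0 ->
  (forall m, schwartz (phi_ m)) ->
  (forall m (x : R), `|phi_ m x| <= K) ->
  (forall m (x : R), K' < `|x| -> phi_ m x = 0) ->
  {ae @lebesgue_measure R, forall x : R, phi_ m x @[m --> \oo] --> rect01 x} ->
  \int[@lebesgue_measure R]_r u (xi * phi_ m r) @[m --> \oo] --> u xi.
Proof.
move=> cu u0 sphi bphi supp cphi.
have mphi m : measurable_fun setT (phi_ m).
  apply: continuous_measurable_fun => x.
  by apply: differentiable_continuous; apply/derivable1_diffP; have [/(_ 0%N x)] := sphi m.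
have mu' (phi : R -> R) : measurable_fun setT phi ->
    measurable_fun setT (fun r => u (xi * phi r)).
  move=> m; have m' : measurable_fun setT (fun r => xi * phi r) by exact: measurable_funM.
  exact: (measurableT_comp (continuous_measurable_fun cu) m').
have urect (r : R) : u (xi * rect01 r) = u xi * \1_`]0, 1] r.
  by rewrite /rect01 indicE; case: (_ \in _); rewrite ?mulr1// !mulr0 u0.
have -> : u xi = \int[@lebesgue_measure R]_r u (xi * rect01 r).
  under eq_Rintegral do rewrite urect.
  rewrite RintegralZl//; last exact: integrable_indic_itv.
  rewrite /Rintegral integral_indic// setIT.
  have L : lebesgue_measure `]0, 1] = 1%:E :> \bar R.
    by have := lebesgue_measure_itv `](0 : R), 1]; rewrite /= lte_fin ltr01 -EFinB subr0.
  rewrite -[LHS]mulr1; congr (_ * _).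
  exact: (esym (congr1 fine L)).
have [M uM] : exists M, forall y, `|y| <= `|xi| * K -> `|u y| <= M.
  have : compact (`[- (`|xi| * K), `|xi| * K]%classic : set R) by exact: segment_compact.
  move=> /(@continuous_compact _ _ u) /= => /(_ _)/compact_bounded [].
    exact: continuous_subspaceT.
  move=> M [_ MP]; exists (M + 1) => y yK.
  apply: (MP (M + 1)); first by rewrite ltrDl.
  by exists y => //; rewrite /= in_itv/= -ler_norml.
apply: (@cvg_Rintegral _ _ _ (@lebesgue_measure R)
  (fun m r => u (xi * phi_ m r)) (fun r => u (xi * rect01 r))
  (fun r => M * \1_`[- K', K'] r)).
- by move=> m; exact: mu'.
- by apply: mu'; exact: measurable_indic.
- apply: (@filterS _ _ (ae_filter_ringOfSetsType (@lebesgue_measure R)) _ _ _ cphi) => x cx.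
  apply: continuous_cvg; first exact: cu.
  exact: cvgMr.
- have := integrableZl measurableT M (@integrable_indic_itv R (- K') K' true false).
  exact.
move=> m x; rewrite indicE; have [xK|xK] := boolP (x \in _).
  by rewrite mulr1; apply: uM; rewrite normrM ler_wpM2l.
rewrite supp ?mulr0 ?u0 ?normr0//.
rewrite ltNge; apply/negP => xK'; move/negP: xK; apply.
by rewrite inE/= in_itv/= -ler_norml.
Qed.

Lemma char_fun_extended_pairing (w : T -> (R -> R) -> R) (f : R -> R[i])
    (X : T -> R) : measurable_fun setT X ->
  levy_white_noise P w f -> extended_pairing P w (@rect01 R) X ->
  forall xi, char_fun P X xi = cexp (f xi).
Proof.
move=> mX [[d0 [T0 [P0 [X0 [_ cf f0 _]]]]] [_ mw] _ _ cw].
move=> [phi_ [sphi [K bphi] [K' supp] cphi cvX]] xi.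
have mY m : measurable_fun setT (w^~ (phi_ m)).
  move=> _ B mB; rewrite setTI.
  have : cylinder [set u : (R -> R) -> R | B (u (phi_ m))].
    by apply: sub_sigma_algebra; exists (phi_ m) => //; exists B.
  by move=> /mw.
have Re0 : complex.Re (f 0) = 0 by rewrite f0.
have Im0 : complex.Im (f 0) = 0 by rewrite f0.
have cRe := rect01_Rintegral_limit (continuous_Re cf) Re0 sphi bphi supp cphi (xi := xi).
have cIm := rect01_Rintegral_limit (continuous_Im cf) Im0 sphi bphi supp cphi (xi := xi).
have cE := cvg_continuous_comp (@continuous_expR R) cRe.
have cC := cvg_continuous_comp (@continuous_cos R) cIm.
have cS := cvg_continuous_comp (@continuous_sin R) cIm.
have eq m := (cw (phi_ m) xi (sphi m)).2.
have hC := cvg_in_probability_Rintegral (@continuous_cos R)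
  (@cos_nonexpansive R) (@cos_max R) mY mX cvX (xi := xi).
have hS := cvg_in_probability_Rintegral (@continuous_sin R)
  (@sin_nonexpansive R) (@sin_max R) mY mX cvX (xi := xi).
rewrite char_funE cexp_ReIm; congr (_ +i* _).
- have E m : \int[P]_t cos (xi * w t (phi_ m)) =
      expR (\int[@lebesgue_measure R]_r complex.Re (f (xi * phi_ m r)))
      * cos (\int[@lebesgue_measure R]_r complex.Im (f (xi * phi_ m r))).
    by have := congr1 (@complex.Re R) (eq m); rewrite char_funE cexp_ReIm /=; exact.
  have lim : \int[P]_t cos (xi * w t (phi_ m)) @[m --> \oo] -->
      expR (complex.Re (f xi)) * cos (complex.Im (f xi)).
    by under eq_cvg do rewrite E; exact: cvgM.
  exact: (cvg_unique (@Rhausdorff R) hC lim).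
- have E m : \int[P]_t sin (xi * w t (phi_ m)) =
      expR (\int[@lebesgue_measure R]_r complex.Re (f (xi * phi_ m r)))
      * sin (\int[@lebesgue_measure R]_r complex.Im (f (xi * phi_ m r))).
    by have := congr1 (@complex.Im R) (eq m); rewrite char_funE cexp_ReIm /=; exact.
  have lim : \int[P]_t sin (xi * w t (phi_ m)) @[m --> \oo] -->
      expR (complex.Re (f xi)) * sin (complex.Im (f xi)).
    by under eq_cvg do rewrite E; exact: cvgM.
  exact: (cvg_unique (@Rhausdorff R) hS lim).
Qed.

End white_noise_char_fun.

(** * Scaling a Levy exponent scales the second moment *)

Section moments_of_amplitudes.
Context {R : realType}.

Lemma integrable_of_sqr d (T : measurableType d) (P : probability T R)
    (X : T -> R) : measurable_fun setT X ->
  P.-integrable setT (EFin \o (fun t => X t ^+ 2)) ->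
  P.-integrable setT (EFin \o X).
Proof.
move=> mX iX.
have i1 : P.-integrable setT (EFin \o (fun=> 1 : R)).
  by apply: (@integrable_bounded _ _ _ P _ 1) => // x; rewrite normr1.
apply: (le_integrable measurableT _ _ (integrableD measurableT i1 iX)).
  exact/measurable_EFinP.
move=> t _ /=; rewrite lee_fin [leRHS]ger0_norm ?addr_ge0 ?sqr_ge0//.
rewrite -[X t ^+ 2]real_normK ?num_real//.
have := sqr_ge0 (`|X t| - 1); have := normr_ge0 (X t); nra.
Qed.

(** Moments and exponents determine each other through the expansion at the
origin, and [f] scales linearly there; the two variables are compared along
[h m = 1 / (m + 1)]. *)
Lemma moments_scale_char_fun d (T : measurableType d) (P : probability T R)
    d' (T' : measurableType d') (Q : probability T' R)
    (f : R -> R[i]) (c : R) (X : T -> R) (A : T' -> R) :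
  continuous (f : R -> R[i]^o) -> f 0 = 0 ->
  measurable_fun setT X -> measurable_fun setT A ->
  (forall xi, char_fun P X xi = cexp (f xi)) ->
  (forall xi, char_fun Q A xi = cexp (c%:C * f xi)) ->
  P.-integrable setT (EFin \o (fun t => X t ^+ 2)) ->
  \int[P]_t X t = 0 ->
  [/\ Q.-integrable setT (EFin \o (fun t => A t ^+ 2)),
      \int[Q]_t A t = 0 &
      \int[Q]_t (A t ^+ 2) = c * \int[P]_t (X t ^+ 2)].
Proof.
move=> cf f0 mX mA hX hA iX2 X0.
pose h : nat -> R := harmonic.
have h0 m : h m != 0 by rewrite lt0r_neq0// harmonic_gt0.
have hc : h m @[m --> \oo] --> (0 : R) := cvg_harmonic.
pose a m := complex.Re (f (h m)); pose b m := complex.Im (f (h m)).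
have a0 : a m @[m --> \oo] --> (0 : R).
  have := cvg_continuous_comp (continuous_Re cf) hc.
  by rewrite /= f0.
have b0 : b m @[m --> \oo] --> (0 : R).
  have := cvg_continuous_comp (continuous_Im cf) hc.
  by rewrite /= f0.
have XE m : \int[P]_t cos (h m * X t) = expR (a m) * cos (b m) /\
            \int[P]_t sin (h m * X t) = expR (a m) * sin (b m).
  by have := hX (h m); rewrite char_funE cexp_ReIm => -[-> ->].
have AE m : \int[Q]_t cos (h m * A t) = expR (c * a m) * cos (c * b m) /\
            \int[Q]_t sin (h m * A t) = expR (c * a m) * sin (c * b m).
  have := hA (h m); rewrite char_funE cexp_ReIm /a /b.
  by case: (f (h m)) => u v; simpc => -[-> ->].
have sX : expR (a m) * sin (b m) / h m @[m --> \oo] --> (0 : R).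
  have := mean_of_char_fun h0 hc mX (integrable_of_sqr mX iX2).
  rewrite X0; under eq_cvg do rewrite (XE _).2; exact.
set V := \int[P]_t (X t ^+ 2).
have cX : (1 - expR (a m) * cos (b m)) / h m ^+ 2 @[m --> \oo] --> V / 2.
  have H := second_moment_of_char_fun h0 hc mX iX2.
  have E m : (1 - expR (a m) * cos (b m)) / h m ^+ 2 =
     (2 * (1 - \int[P]_t cos (h m * X t)) / h m ^+ 2) / 2.
    by rewrite (XE m).1; field; exact: h0.
  by under eq_cvg do rewrite E; exact: cvgMl.
have [sA cA] := levy_scaling c h0 a0 b0 sX cX.
have cA2 : 2 * (1 - \int[Q]_t cos (h m * A t)) / h m ^+ 2
    @[m --> \oo] --> c * V.
  have -> : c * V = 2 * (c * (V / 2)) by field.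
  under eq_cvg do rewrite (AE _).1 -mulrA; exact: cvgMr.
have iA2 := square_integrable_of_char_fun h0 hc mA cA2.
split => //.
- have := mean_of_char_fun h0 hc mA (integrable_of_sqr mA iA2).
  under eq_cvg do rewrite (AE _).2.
  move=> H; exact: (cvg_unique (@Rhausdorff R) H sA).
- have H := second_moment_of_char_fun h0 hc mA iA2.
  exact: (cvg_unique (@Rhausdorff R) H cA2).
Qed.

End moments_of_amplitudes.

(** * Integrals and independence *)

Section independent_product.
Context d (T : measurableType d) (R : realType) (P : probability T R).

Lemma measurable_mulR2 : measurable_fun setT (fun z : R * R => z.1 * z.2).
Proof. by apply: measurable_funM; [exact: measurable_fst|exact: measurable_snd]. Qed.

(** Independence makes the law of the pair the product of the two laws, and
Fubini's theorem separates the variables. *)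
Lemma independent_integralM (X Y : T -> R) :
  measurable_fun setT X -> measurable_fun setT Y -> independent P X Y ->
  P.-integrable setT (EFin \o X) -> P.-integrable setT (EFin \o Y) ->
  P.-integrable setT (EFin \o (fun t => X t * Y t)) ->
  (\int[P]_t (X t * Y t)%:E = \int[P]_t (X t)%:E * \int[P]_t (Y t)%:E)%E.
Proof.
move=> mX mY indXY iX iY iXY.
have mXY := measurable_fun_pair mX mY.
pose Z : {mfun T >-> (R * R)%type} := mfun_Sub (mem_set mXY).
pose X' : {RV P >-> R} := mfun_Sub (mem_set mX).
pose Y' : {RV P >-> R} := mfun_Sub (mem_set mY).
pose mu := distribution P X'; pose nu := distribution P Y'.
have ZE S : measurable S -> (mu \x nu)%E S = distribution P Z S.
  apply: product_measure_unique => A B mA mB.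
  by have := indXY _ _ mA mB.
pose g (z : R * R) : \bar R := (z.1 * z.2)%:E.
have mg : measurable_fun setT g by apply/measurable_EFinP; exact: measurable_mulR2.
have iZ : (distribution P Z).-integrable setT g.
  apply/integrableP; split => //.
  rewrite ge0_integral_distribution//; last exact: measurableT_comp.
  by have /integrableP[] := iXY.
have ig : (mu \x nu)%E.-integrable setT g.
  apply/integrableP; split => //.
  rewrite (eq_measure_integral (distribution P Z)); last by move=> S mS _; exact: ZE.
  by have /integrableP[] := iZ.
have -> : (\int[P]_t (X t * Y t)%:E = \int[mu \x nu]_z g z)%E.
  rewrite (eq_measure_integral (distribution P Z)); last by move=> S mS _; exact: ZE.
  by rewrite integral_distribution.
rewrite -(integral12_prod_meas1 ig) /fubini_F /g /=.
have inu : nu.-integrable setT EFin.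
  apply/integrableP; split; first exact: EFin_measurable.
  rewrite ge0_integral_distribution//; last first.
    by apply: measurableT_comp => //; exact: EFin_measurable.
  by have /integrableP[] := iY.
have imu : mu.-integrable setT EFin.
  apply/integrableP; split; first exact: EFin_measurable.
  rewrite ge0_integral_distribution//; last first.
    by apply: measurableT_comp => //; exact: EFin_measurable.
  by have /integrableP[] := iX.
have EX : (\int[P]_t (X t)%:E = \int[mu]_x x%:E)%E.
  by rewrite integral_distribution//; exact: EFin_measurable.
have EY : (\int[P]_t (Y t)%:E = \int[nu]_x x%:E)%E.
  by rewrite integral_distribution//; exact: EFin_measurable.
rewrite EX EY.
have inner x : (\int[nu]_y (x * y)%:E = x%:E * \int[nu]_y y%:E)%E.
  by rewrite -integralZl.
under eq_integral do rewrite inner.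
have nf : (\int[nu]_y y%:E)%E \is a fin_num by exact: integrable_fin_num.
by rewrite -(fineK nf) integralZr.
Qed.

End independent_product.

(** * Intensity of the Poisson process *)

Section almost_sure_partition.
Local Open Scope ereal_scope.
Context d (T : measurableType d) (R : realType) (P : probability T R).
Variable H : nat -> set T.
Hypotheses (mH : forall i, measurable (H i)) (tH : trivIset setT H).
Hypothesis PH : P (\bigcup_i H i) = 1.

Let mUH : measurable (\bigcup_i H i).
Proof. exact: bigcup_measurable. Qed.

Let PUHC : P (~` \bigcup_i H i) = 0.
Proof. by rewrite probability_setC// PH subee. Qed.

Lemma ge0_integral_ae_partition (f : T -> \bar R) : measurable_fun setT f ->
  (forall t, 0 <= f t) ->
  \int[P]_t f t = \sum_(0 <= i <oo) \int[P]_(t in H i) f t.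
Proof.
move=> mf f0.
rewrite -ge0_integral_bigcup//; last exact: measurable_funTS.
rewrite -(setUv (\bigcup_i H i)) ge0_integral_setU//=.
- rewrite [X in _ + X]null_set_integral ?adde0//; first exact: measurableC.
  exact: measurable_funTS.
- exact: measurableC.
- by rewrite setUv.
- by apply/disj_setPS; rewrite setICr.
Qed.

Lemma integral_ae_partition (f : T -> \bar R) : P.-integrable setT f ->
  \int[P]_t f t = \sum_(0 <= i <oo) \int[P]_(t in H i) f t.
Proof.
move=> intf; rewrite -integral_bigcup//; last by apply: integrableS intf.
rewrite [LHS](negligible_integral (N := ~` \bigcup_i H i))//.
  by rewrite setTD setCK.
exact: measurableC.
Qed.

End almost_sure_partition.

Section poisson_mean.
Local Open Scope ereal_scope.
Context {R : realType}.

Lemma poisson_pmf_sum (rate : R) : (0 < rate)%R ->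
  \sum_(0 <= j <oo) (poisson_pmf rate j)%:E = 1.
Proof.
move=> r0; have pE : (if (0 < rate)%R then
    \esum_(j in [set: nat]) (poisson_pmf rate j)%:E else \d_0%N setT) = 1.
  exact: probability_setT (poisson_prob rate 0%N).
rewrite r0 in pE.
by rewrite nneseries_esumT// => j; rewrite lee_fin poisson_pmf_ge0.
Qed.

Lemma poisson_pmfS (rate : R) j : (0 < rate)%R ->
  (j.+1%:R * poisson_pmf rate j.+1 = rate * poisson_pmf rate j)%R.
Proof.
move=> r0; rewrite /poisson_pmf r0 exprS factS natrM invfM.
have : (j.+1%:R : R) != 0%R by rewrite pnatr_eq0.
by move: (j.+1%:R : R) (j`!%:R^-1%R : R) => y c y0; field.
Qed.

Lemma poisson_pmf_mean (rate : R) : (0 < rate)%R ->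
  \sum_(0 <= j <oo) (j%:R * poisson_pmf rate j)%:E = rate%:E.
Proof.
move=> r0.
have ge0 j : 0 <= (j%:R * poisson_pmf rate j)%:E.
  by rewrite lee_fin mulr_ge0// poisson_pmf_ge0.
rewrite nneseries_recl// mul0r add0e -(nneseries_addn 1)//.
under eq_eseriesr do rewrite addn1 poisson_pmfS// EFinM.
rewrite nneseriesZl; first by rewrite poisson_pmf_sum// mule1.
by move=> j _; rewrite lee_fin poisson_pmf_ge0.
Qed.

(** The masses [p j] sum to [1], so almost surely [N] is one of the natural
numbers, and the infinite value does not contribute. *)
Lemma integral_of_pmf d (T : measurableType d) (P : probability T R)
    (N : T -> \bar R) (p : nat -> R) : measurable_fun setT N ->
  (forall t, 0 <= N t) ->
  (forall j, P [set t | N t = j%:R%:E] = (p j)%:E) ->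
  \sum_(0 <= j <oo) (p j)%:E = 1 ->
  \int[P]_t N t = \sum_(0 <= j <oo) (j%:R * p j)%:E.
Proof.
move=> mN N0 PN p1.
pose H (j : nat) := [set t | N t = j%:R%:E].
have mH j : measurable (H j).
  by rewrite -[H j]setTI; exact: (mN measurableT [set j%:R%:E]).
have tH : trivIset setT H.
  apply/trivIsetP => i j _ _ ij; apply/seteqP; split => // t [] /=; rewrite /H /= => -> [].
  by move/eqP; rewrite eqr_nat (negbTE ij).
have PH : P (\bigcup_j H j) = 1.
  rewrite measure_semi_bigcup//; last exact: bigcup_measurable.
  by rewrite -p1; apply: eq_eseriesr => j _; exact: PN.
rewrite (ge0_integral_ae_partition mH tH PH)//.
apply: eq_eseriesr => j _.
rewrite (eq_integral (cst j%:R%:E)); last by move=> t; rewrite inE.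
by rewrite integral_cst// EFinM; congr (_ * _); exact: PN.
Qed.

End poisson_mean.

Section poisson_intensity.
Local Open Scope ereal_scope.
Context d (T : measurableType d) (R : realType) (P : probability T R).

(** Impulses are indexed by integers; the bijection lets series and the
Borel-Cantelli lemma run over natural numbers. *)
Definition int_of_index (m : nat) : int :=
  if odd m then Negz m./2 else Posz m./2.

Lemma int_of_index_bij : bijective int_of_index.
Proof.
exists (fun k : int => match k with Posz n => n.*2 | Negz n => n.*2.+1 end).
  move=> m; rewrite /int_of_index -[RHS]odd_double_half.
  by case: (odd m).
by case=> n; rewrite /int_of_index/= odd_double/= ?doubleK// uphalf_double.
Qed.

Variables (lambda : R) (tau : int -> {RV P >-> R}).
Hypothesis lambda_gt0 : (0 < lambda)%R.
Hypothesis tauP : poisson_process P lambda (fun k => tau k : T -> R).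

Let e := int_of_index.

Lemma measurable_RV_preimage (X : {RV P >-> R}) (B : set R) : measurable B ->
  measurable (X @^-1` B).
Proof. by move=> mB; rewrite -[_ @^-1` _]setTI; exact: measurable_funPT. Qed.

Lemma num_pointsE (B : set R) t :
  num_points tau B t = \sum_(0 <= m <oo) (\1_(tau (e m) @^-1` B) t)%:E.
Proof.
rewrite /num_points (reindex_esum [set: nat] _ e)//.
  by rewrite nneseries_esumT// => m; rewrite lee_fin.
by rewrite setTT_bijective; exact: int_of_index_bij.
Qed.

Lemma integral_num_points (B : set R) : measurable B ->
  \int[P]_t num_points tau B t
  = \sum_(0 <= m <oo) P (tau (e m) @^-1` B).
Proof.
move=> mB; under eq_integral do rewrite num_pointsE.
rewrite integral_nneseries//.
- apply: eq_eseriesr => m _; rewrite integral_indic// ?setIT//.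
  exact: measurable_RV_preimage.
- move=> m; apply/measurable_EFinP; apply: measurable_indic.
  exact: measurable_RV_preimage.
Qed.

(** The expected number of points of an interval, computed from the Poisson law,
is also the sum over [m] of the probabilities that the m-th point lies in it. *)
Lemma poisson_intensity (a b : R) : (a < b)%R ->
  \sum_(0 <= m <oo) P (tau (e m) @^-1` `[a, b]) = (lambda * (b - a))%:E.
Proof.
move=> ab; rewrite -(integral_num_points (measurable_itv `[a, b])).
have r0 : (0 < lambda * (b - a))%R by rewrite mulr_gt0// subr_gt0.
rewrite -(poisson_pmf_mean r0).
apply: integral_of_pmf => [|t|j|].
- rewrite (funext (num_pointsE `[a, b])).
  apply: (@ge0_emeasurable_sum _ _ _ _ _ predT) => // m _.
  apply/measurable_EFinP; apply: measurable_indic.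
  exact: (measurable_RV_preimage _ (measurable_itv _)).
- by rewrite num_pointsE; apply: nneseries_ge0 => m _ _; rewrite lee_fin.
- exact: (proj1 tauP a b j ab).
- exact: poisson_pmf_sum.
Qed.

(** The m-th location hits [x] with probability at most the expected number of
points in [[x, x + c / lambda]], which is [c], for every [c > 0]. *)
Lemma poisson_no_atom (x : R) m : P (tau (e m) @^-1` [set x]) = 0.
Proof.
apply/eqP; rewrite eq_le measure_ge0 andbT; apply/lee_addgt0Pr => c c0.
rewrite add0e.
have xc : (x < x + c / lambda)%R by rewrite ltrDl divr_gt0.
have := poisson_intensity xc.
rewrite (_ : lambda * (x + c / lambda - x) = c)%R; last first.
  by field; rewrite gt_eqF.
move=> <-.
apply: (@le_trans _ _ (P (tau (e m) @^-1` `[x, (x + c / lambda)%R]))).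
  apply: le_measure; rewrite ?inE.
  - exact: measurable_RV_preimage.
  - exact: (measurable_RV_preimage _ (measurable_itv _)).
  by move=> t /= ->; rewrite in_itv/= lexx ltW.
rewrite (nneseries_split 0%N m.+1) => [|k _]; last exact: measure_ge0.
rewrite add0n big_mkord big_ord_recr/= -addeA addeCA leeDl//.
apply: adde_ge0; first by apply: sume_ge0 => k _; exact: measure_ge0.
by apply: nneseries_ge0 => k _ _; exact: measure_ge0.
Qed.

(** The Poisson law is given on closed intervals; removing the endpoint [0]
changes nothing, as no location has an atom. *)
Lemma poisson_intensity_rect01 :
  \sum_(0 <= m <oo) P (tau (e m) @^-1` `]0%R, 1%R]) = lambda%:E.
Proof.
have := poisson_intensity (@ltr01 R); rewrite subr0 mulr1 => <-.
apply: eq_eseriesr => m _.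
have -> : `[0%R, 1%R]%classic = [set 0%R] `|` `]0%R, 1%R]%classic :> set R.
  by rewrite setU1itv// bnd_simp.
rewrite preimage_setU measureU//=.
- by rewrite poisson_no_atom add0e.
- exact: (measurable_RV_preimage _ (measurable_itv _)).
by apply/seteqP; split => // t [] /= ->; rewrite in_itv/= ltxx.
Qed.

End poisson_intensity.

(** * Sums over a random finite set of indices *)

(** [C] generates the sigma-algebra of the locations, [F m] is the event that
the term [Z m] is selected, and the hypotheses on [Z] are what independence from
[C] yields for centered uncorrelated terms of variance [v]. *)
Section random_sum.
Local Open Scope ereal_scope.
Context d (T : measurableType d) (R : realType) (P : probability T R).
Variables (C : set_system T) (Z : nat -> T -> R) (F : nat -> set T).
Variables (v : R) (W : T -> R).
Hypothesis subC : <<s C>> `<=` measurable.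
Hypothesis CF : forall m, <<s C>> (F m).
Hypothesis mZ : forall m, measurable_fun setT (Z m).
Hypothesis iZ : forall m, P.-integrable setT (EFin \o Z m).
Hypothesis iZZ : forall m l, P.-integrable setT (EFin \o (fun t => Z m t * Z l t)%R).
Hypothesis Z_mean : forall m E, <<s C>> E -> \int[P]_(t in E) (Z m t)%:E = 0.
Hypothesis Z_cross : forall m l E, <<s C>> E ->
  \int[P]_(t in E) (Z m t * Z l t)%:E = if m == l then v%:E * P E else 0.
Hypothesis sumF : \sum_(0 <= m <oo) P (F m) < +oo.
Hypothesis WE : forall t, W t = (\sum_(m \in [set: nat]) (Z m t * \1_(F m) t))%R.

Let Y m t := (Z m t * \1_(F m) t)%R.

Let mF m : measurable (F m). Proof. exact: subC (CF m). Qed.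

Let mY m : measurable_fun setT (Y m).
Proof. by apply: measurable_funM => //; exact: measurable_indic. Qed.

Let W_finite M t : (forall m, (M <= m)%N -> Y m t = 0%R) ->
  W t = (\sum_(m < M) Y m t)%R.
Proof.
move=> Y0; rewrite WE (fsbig_ord _ _ (fun m => Y m t)); apply/esym/fsbig_widen => // m [_ /= /negP].
by rewrite -leqNgt; exact: Y0.
Qed.

Let W_infinite t : ~ (exists M, forall m, (M <= m)%N -> Y m t = 0%R) -> W t = 0%R.
Proof.
move=> nM; rewrite WE; apply: fsbig_dflt => fin; apply: nM.
have /finite_seqP[s sE] := fin.
exists (\max_(i <- s) i).+1 => m sm; apply: contrapT => Ym.
have : m \in s.
  have : [set` s] m by rewrite -sE; split.
  by [].
by move=> /(@leq_bigmax_seq _ s predT id) => /(_ isT); rewrite leqNgt sm.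
Qed.

(** [W] vanishes where infinitely many terms are nonzero; elsewhere it is the
eventual value of the partial sums.  Multiplying these by the indicator of [K]
therefore makes them converge to [W] everywhere, not only almost surely. *)
Lemma measurable_random_sum : measurable_fun setT W.
Proof.
pose K := \bigcup_M \bigcap_(m in [set m | (M <= m)%N]) (Y m @^-1` [set 0%R]).
have mK : measurable K.
  apply: bigcup_measurable => M _; apply: bigcap_measurableType => m _.
  by rewrite -[_ @^-1` _]setTI; exact: mY.
apply: (measurable_fun_cvg (h := fun M t => (\1_K t * \sum_(m < M) Y m t)%R)).
  move=> M; apply: measurable_funM; first exact: measurable_indic.
  by apply: measurable_sum.
move=> t _; have [[M _ KM]|Kt] := pselect (K t).
  apply: cvg_near_cst; exists M => // N /= MN.
  rewrite indicE mem_set ?mul1r; last by exists M.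
  by apply/esym/W_finite => m Nm; apply: KM => /=; exact: leq_trans MN Nm.
rewrite W_infinite; last by case=> M YM; apply: Kt; exists M.
under eq_cvg do rewrite indicE memNset// mul0r.
exact: cvg_cst.
Qed.

(* On [H M], no index from [M] on is selected, and [M] is minimal. *)
Let G M := \bigcap_(m in [set m | (M <= m)%N]) ~` F m.
Let H := seqD G.

Let ndG : {homo G : M N / (M <= N)%N >-> (M <= N)%O}.
Proof.
move=> M N MN; apply/subsetPset => t GM m /= Nm.
by apply: GM => /=; exact: leq_trans MN Nm.
Qed.

Let CH M : <<s C>> (H M).
Proof.
pose TC := g_sigma_algebraType C.
have mG N : measurable (G N : set TC).
  apply: bigcap_measurableType => m _; apply: measurableC; exact: CF.
suff : measurable (H M : set TC) by [].
by case: M => [|M] /=; [exact: mG|exact: measurableD].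
Qed.

Let mH M : measurable (H M). Proof. exact: subC (CH M). Qed.

Let tH : trivIset setT H. Proof. exact: trivIset_seqD. Qed.

Let notF M t m : H M t -> (M <= m)%N -> ~ F m t.
Proof.
move=> HM Mm; have : G M t by case: M HM {Mm} => [|M] //= [].
by move=> /(_ m); exact.
Qed.

(* The Borel-Cantelli lemma. *)
Let PH : P (\bigcup_M H M) = 1.
Proof.
have -> : \bigcup_M H M = ~` lim_sup_set F.
  rewrite eq_bigcup_seqD /lim_sup_set setC_bigcap; apply: eq_bigcupr => M _.
  by rewrite setC_bigcup.
have m0 : measurable (lim_sup_set F).
  by apply: bigcap_measurableType => M _; apply: bigcup_measurable.
rewrite probability_setC//.
have -> := lim_sup_set_cvg0 mF sumF.
by rewrite sube0.
Qed.

Let PHC : P (~` \bigcup_M H M) = 0.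
Proof. by rewrite probability_setC ?PH ?subee//; exact: bigcup_measurable. Qed.

Let CIF D m l : <<s C>> D -> <<s C>> (D `&` (F m `&` F l)).
Proof.
move=> CD; pose TC := g_sigma_algebraType C.
suff : measurable (D `&` (F m `&` F l) : set TC) by [].
apply: measurableI; first exact: CD.
by apply: measurableI; exact: CF.
Qed.

Let YE m : EFin \o Y m = (EFin \o Z m) \_ (F m).
Proof.
apply/funext => t; rewrite /Y /= patchE indicE; case: ifP => _.
  by rewrite mulr1.
by rewrite mulr0.
Qed.

Let YYE m l :
  EFin \o (fun t => Y m t * Y l t)%R =
  (EFin \o (fun t => Z m t * Z l t)%R) \_ (F m `&` F l).
Proof.
apply/funext => t; rewrite /Y /= patchE !indicE in_setI.
by case: (t \in F m) (t \in F l) => -[] /=; congr EFin; ring.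
Qed.

Let integrable_patch (f : T -> \bar R) (A D : set T) :
  measurable A -> measurable D ->
  P.-integrable setT f -> P.-integrable D (f \_ A).
Proof.
move=> mA mD fi; apply: (@integrableS _ _ _ _ setT) => //.
by apply/(integrable_mkcond _ mA); exact: integrableS fi.
Qed.

Let iY m D : measurable D -> P.-integrable D (EFin \o Y m).
Proof. by move=> mD; rewrite YE; exact: integrable_patch. Qed.

Let iYY m l D : measurable D ->
  P.-integrable D (EFin \o (fun t => Y m t * Y l t)%R).
Proof. by move=> mD; rewrite YYE; apply: integrable_patch => //; exact: measurableI. Qed.

Let Y_mean m D : <<s C>> D -> \int[P]_(t in D) (Y m t)%:E = 0.
Proof.
move=> CD; transitivity (\int[P]_(t in D) (EFin \o Y m) t); first by [].
by rewrite YE -integral_mkcondr Z_mean// -(setIid (F m)); exact: CIF.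
Qed.

Let Y_cross m l D : <<s C>> D ->
  \int[P]_(t in D) (Y m t * Y l t)%:E =
  if m == l then v%:E * P (D `&` F m) else 0.
Proof.
move=> CD.
transitivity (\int[P]_(t in D) (EFin \o (fun t => Y m t * Y l t)%R) t); first by [].
rewrite YYE -integral_mkcondr Z_cross; last exact: CIF.
by case: eqP => // <-; rewrite setIid.
Qed.

Let W_H M t : H M t -> W t = (\sum_(m < M) Y m t)%R.
Proof.
move=> HMt; apply: W_finite => m Mm.
by rewrite /Y indicE memNset ?mulr0//; exact: notF HMt Mm.
Qed.

Let W_mean_H M : \int[P]_(t in H M) (W t)%:E = 0.
Proof.
rewrite (eq_integral (fun t => \sum_(m < M) (Y m t)%:E)); last first.
  by move=> t; rewrite inE => /W_H ->; rewrite sumEFin.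
rewrite (@integral_sum _ _ _ P _ (mH M) _ (fun m : 'I_M => EFin \o Y m)).
  by rewrite big1// => m _; exact: Y_mean.
by move=> m; exact: iY.
Qed.

(* Only the diagonal terms of the expanded square survive. *)
Let W_sqr_H M : \int[P]_(t in H M) (W t ^+ 2)%:E =
  v%:E * \sum_(0 <= m <oo) P (H M `&` F m).
Proof.
rewrite (eq_integral (fun t => \sum_(m < M) \sum_(l < M) (Y m t * Y l t)%:E)); last first.
  move=> t; rewrite inE => /W_H ->.
  rewrite expr2 mulr_suml -sumEFin; apply: eq_bigr => m _.
  by rewrite mulr_sumr sumEFin.
rewrite (@integral_sum _ _ _ P _ (mH M) _
    (fun (m : 'I_M) t => \sum_(l < M) (Y m t * Y l t)%:E)); last first.
  move=> m; apply: (@integrable_sum _ _ _ P _ (mH M) _ _ predT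
    (fun (l : 'I_M) => EFin \o (fun t => Y m t * Y l t)%R)) => l _; exact: iYY.
rewrite (nneseries_split 0%N M) => [|k _]; last exact: measure_ge0.
rewrite [X in _ + X]eseries0; last first.
  move=> m; rewrite add0n => Mm _.
  rewrite (_ : _ `&` _ = set0) ?measure0//.
  by apply/seteqP; split => // t [] /notF/(_ Mm).
rewrite adde0 add0n big_mkord ge0_sume_distrr; last by move=> m _; exact: measure_ge0.
apply: eq_bigr => m _.
rewrite (@integral_sum _ _ _ P _ (mH M) _
    (fun (l : 'I_M) => EFin \o (fun t => Y m t * Y l t)%R)); last first.
  by move=> l; exact: iYY.
rewrite (bigD1 m)//= Y_cross// eqxx big1 ?adde0// => l lm.
by rewrite Y_cross// (inj_eq val_inj) eq_sym (negbTE lm).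
Qed.

(** Summing over the pieces [H M] turns, after exchanging the two series,
[sum_M P(H M & F m)] into [P(F m)]. *)
Lemma random_sum_second_moment :
  \int[P]_t (W t ^+ 2)%:E = v%:E * \sum_(0 <= m <oo) P (F m).
Proof.
(* [v] is the second moment of [Z 0]. *)
have v0 : (0 <= v)%R.
  have := Z_cross 0 0 (@measurableT _ (g_sigma_algebraType C)).
  rewrite eqxx [P _]probability_setT mule1 => vE; rewrite -lee_fin -vE.
  by apply: integral_ge0 => t _; rewrite lee_fin -expr2 sqr_ge0.
have mW2 : measurable_fun setT (fun t => (W t ^+ 2)%:E).
  by apply/measurable_EFinP; apply: measurable_funX; exact: measurable_random_sum.
rewrite (ge0_integral_ae_partition mH tH PH)//; last by move=> t; rewrite lee_fin sqr_ge0.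
rewrite (eq_eseriesr (fun M _ => W_sqr_H M)).
rewrite nneseriesZl; last by move=> M _; apply: nneseries_ge0.
rewrite nneseries_interchange//; congr (_ * _).
apply: eq_eseriesr => m _.
rewrite -(@measure_semi_bigcup _ _ _ P (fun M => H M `&` F m)).
- rewrite -setI_bigcupl setIC.
  have mU : measurable (\bigcup_M H M) by exact: bigcup_measurable.
  rewrite [RHS](measureDI P (mF m) mU).
  rewrite [X in X + _](_ : _ = 0) ?add0e//.
  apply: (@subset_measure0 _ _ _ P _ (~` \bigcup_M H M)).
  + exact: measurableD.
  + exact: measurableC.
  + by move=> t [].
  + exact: PHC.
- by move=> M; exact: measurableI.
- exact: trivIset_setIr.
- by apply: bigcup_measurable => M _; exact: measurableI.
Qed.

Lemma random_sum_mean : \int[P]_t (W t)%:E = 0.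
Proof.
have mW := measurable_random_sum.
have iW : P.-integrable setT (EFin \o W).
  apply: integrable_of_sqr => //; apply/integrableP; split.
    by apply/measurable_EFinP; exact: measurable_funX.
  under eq_integral do rewrite /= ger0_norm ?sqr_ge0//.
  rewrite random_sum_second_moment.
  have := sumF; have : 0 <= \sum_(0 <= m <oo) P (F m) by exact: nneseries_ge0.
  by case: (\sum_(0 <= m <oo) P (F m)) => [r| |]//= _ _; rewrite -EFinM ltry.
rewrite (integral_ae_partition mH tH PH)//.
by rewrite eseries0// => M _ _; exact: W_mean_H.
Qed.

End random_sum.

(** * Moments of the compound-Poisson observation *)

Section independent_sigma_algebras.
Context d (T : measurableType d) (R : realType) (P : probability T R).

(** [X] is independent of the indicator of [E], whose preimages stay in the
sigma-algebra generated by [C]. *)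
Lemma integral_independent_event (C : set_system T) (X : T -> R) (E : set T) :
  <<s C>> `<=` measurable -> measurable_fun setT X ->
  P.-integrable setT (EFin \o X) ->
  (forall (B : set R) D, measurable B -> <<s C>> D ->
     P (X @^-1` B `&` D) = (P (X @^-1` B) * P D)%E) ->
  <<s C>> E ->
  (\int[P]_(t in E) (X t)%:E = \int[P]_t (X t)%:E * P E)%E.
Proof.
move=> subC mX iX indX CE; have mE := subC _ CE.
pose TC := g_sigma_algebraType C.
have mIC : measurable_fun [set: TC] (\1_(E : set TC) : TC -> R) by exact: measurable_indic.
have mI : measurable_fun setT (\1_E : T -> R) by exact: measurable_indic.
have XIE : EFin \o (fun t => X t * \1_E t) = (EFin \o X) \_ E.
  apply/funext => t /=; rewrite patchE indicE; case: ifP => _.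
    by rewrite mulr1.
  by rewrite mulr0.
have iXI : P.-integrable setT (EFin \o (fun t => X t * \1_E t)).
  by rewrite XIE; apply/(integrable_mkcond _ mE); exact: integrableS iX.
rewrite integral_mkcond.
transitivity (\int[P]_t (X t * \1_E t)%:E)%E.
  by apply: eq_integral => t _; rewrite -XIE.
rewrite independent_integralM//.
- by rewrite integral_indic// setIT.
- move=> B D mB mD; apply: indX => //.
  by have := mIC measurableT _ mD; rewrite setTI.
- apply: (@integrable_bounded _ _ _ P _ 1) => // t.
  by rewrite indicE normr_nat lern1 leq_b1.
Qed.

Lemma sigma_of_subset (I : Type) (X : I -> {RV P >-> R}) :
  sigma_of (fun i => X i : T -> R) `<=` measurable.
Proof.
apply: smallest_sub; first exact: sigma_algebra_measurable.
by move=> E [i [B mB ->]]; exact: measurable_RV_preimage.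
Qed.

Lemma measurable_sigma_of (I : Type) (X : I -> T -> R) i :
  measurable_fun [set: g_sigma_algebraType
    [set E | exists i, exists2 B : set R, measurable B & E = X i @^-1` B]] (X i).
Proof.
move=> _ B mB; rewrite setTI; apply: sub_sigma_algebra.
by exists i; exists B.
Qed.

Lemma mutually_independent_pair (I : choiceType) (X : I -> T -> R) i j :
  mutually_independent P X -> i != j -> independent P (X i) (X j).
Proof.
move=> indX ij B D mB mD.
have := indX [:: i; j] (fun k => if k == i then B else D).
rewrite /= inE ij => /(_ isT) /(_ _); rewrite !big_cons big_nil mule1 eqxx.
rewrite eq_sym (negbTE ij) => <-; last by move=> k; case: ifP.
congr (P _); apply/seteqP; split => t /=.
  move=> [XB XD] k /=; rewrite !inE => /orP[/eqP ->|/eqP ->].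
    by rewrite eqxx.
  by rewrite eq_sym (negbTE ij).
move=> H; split.
  by have /= := H i; rewrite !inE !eqxx/=; exact.
by have /= := H j; rewrite !inE eqxx orbT eq_sym (negbTE ij); exact.
Qed.

End independent_sigma_algebras.

Section square_integrable.
Context d (T : measurableType d) (R : realType) (P : probability T R).

Lemma integrable_mul_sqr (X Y : T -> R) :
  measurable_fun setT X -> measurable_fun setT Y ->
  P.-integrable setT (EFin \o (fun t => X t ^+ 2)) ->
  P.-integrable setT (EFin \o (fun t => Y t ^+ 2)) ->
  P.-integrable setT (EFin \o (fun t => X t * Y t)).
Proof.
move=> mX mY iX iY.
apply: (le_integrable measurableT _ _ (integrableD measurableT iX iY)).
  by apply/measurable_EFinP; exact: measurable_funM.
move=> t _ /=; rewrite lee_fin [leRHS]ger0_norm ?addr_ge0 ?sqr_ge0//.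
rewrite -[X t ^+ 2]real_normK ?num_real// -[Y t ^+ 2]real_normK ?num_real//.
rewrite normrM; have := sqr_ge0 (`|X t| - `|Y t|).
have := normr_ge0 (X t); have := normr_ge0 (Y t); nra.
Qed.

End square_integrable.

Local Open Scope ereal_scope.
Local Open Scope complex_scope.

Section compound_poisson_moments.
Context d (T : measurableType d) (R : realType) (P : probability T R).

(** Wald's identities for the unit interval: the expected number of impulses
there is [lambda]. *)
Lemma compound_poisson_moments (lambda v : R) (f : R -> R[i])
  (A tau : int -> {RV P >-> R}) (W : T -> R) :
  (0 < lambda)%R ->
  compound_poisson_innovation lambda f A tau ->
  (forall k, P.-integrable setT (EFin \o (fun t => A k t ^+ 2)%R)) ->
  (forall k, \int[P]_t (A k t)%:E = 0) ->
  (forall k, \int[P]_t (A k t ^+ 2)%:E = v%:E) ->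
  (forall t, W t = innovation A tau t (@rect01 R)) ->
  \int[P]_t (W t)%:E = 0 /\ \int[P]_t (W t ^+ 2)%:E = (lambda * v)%:E.
Proof.
move=> l0 [tauP [indA _] _ indAtau] iA2 A0 A2 WE.
pose e := int_of_index.
have mA k : measurable_fun setT (A k) by exact: measurable_funPT.
have iA k := integrable_of_sqr (mA k) (iA2 k).
have iAA k l := integrable_mul_sqr (mA k) (mA l) (iA2 k) (iA2 l).
pose C := [set E | exists k : int, exists2 B : set R,
  measurable B & E = tau k @^-1` B].
pose CA := [set E | exists k : int, exists2 B : set R,
  measurable B & E = A k @^-1` B].
have subC : <<s C>> `<=` measurable by exact: sigma_of_subset.
pose F m := tau (e m) @^-1` `]0%R, 1%R].
have CF m : <<s C>> (F m).
  apply: sub_sigma_algebra; exists (e m).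
  by exists `]0%R, 1%R]%classic => //; exact: (measurable_itv `]0%R, 1%R]).
have sumF : \sum_(0 <= m <oo) P (F m) = lambda%:E.
  exact: poisson_intensity_rect01.
have indep (X : T -> R) (B : set R) D :
    measurable_fun [set: g_sigma_algebraType CA] X ->
    measurable B -> <<s C>> D -> P (X @^-1` B `&` D) = P (X @^-1` B) * P D.
  move=> mX mB CD; apply: indAtau => //.
  by have := mX measurableT _ mB; rewrite setTI.
have mCA k : measurable_fun [set: g_sigma_algebraType CA] (A k).
  exact: (@measurable_sigma_of _ _ _ _ (fun k => A k : T -> R)).
have mean m E : <<s C>> E -> \int[P]_(t in E) (A (e m) t)%:E = 0.
  move=> CE; rewrite (integral_independent_event subC)//; first by rewrite A0 mul0e.
  by move=> B D mB CD; exact: indep.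
have cross m l E : <<s C>> E -> \int[P]_(t in E) (A (e m) t * A (e l) t)%:E =
    if m == l then v%:E * P E else 0.
  move=> CE.
  rewrite (@integral_independent_event _ _ _ _ C (fun t => A (e m) t * A (e l) t)%R)//.
  - have [->|ml] := eqVneq m l.
      by under eq_integral do rewrite -expr2; rewrite A2.
    rewrite independent_integralM// ?A0 ?mule0 ?mul0e//.
    apply: (mutually_independent_pair indA).
    by apply: contra ml => /eqP/(bij_inj int_of_index_bij) ->.
  - exact: measurable_funM.
  - move=> B D mB CD; apply: indep => //; exact: measurable_funM.
have WE' t : W t = (\sum_(m \in [set: nat]) (A (e m) t * \1_(F m) t))%R.
  by rewrite WE /innovation (reindex_fsbigT e)//; exact: int_of_index_bij.
have sumFy : \sum_(0 <= m <oo) P (F m) < +oo by rewrite sumF ltry.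
have mZ m := mA (e m).
have iZ m := iA (e m).
have iZZ m l := iAA (e m) (e l).
split.
  exact: (random_sum_mean subC CF mZ iZ iZZ mean cross sumFy WE').
rewrite (random_sum_second_moment subC CF mZ iZZ cross sumFy WE').
by rewrite sumF -EFinM mulrC.
Qed.

End compound_poisson_moments.
Theorem proposition2 (R : realType)
  (d : measure_display) (T : measurableType d) (P : probability T R)
  (w : T -> (R -> R) -> R) (f : R -> R[i]) (Xrect : {RV P >-> R})
  (sigma_w : R)
  (hw : levy_white_noise P w f)
  (hXrect : extended_pairing P w (@rect01 R) Xrect)
  (hmean : 'E_P[Xrect] = 0)
  (hvar : 'E_P[fun t => (Xrect t ^+ 2)%R] = (sigma_w ^+ 2)%:E)
  (n : nat) (hn : (1 <= n)%N)
  (d' : measure_display) (T' : measurableType d') (Q : probability T' R)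
  (A tau : int -> {RV Q >-> R})
  (hwn : compound_poisson_innovation n%:R (fun xi => (n%:R^-1 * f xi)%R) A tau)
  (Xrectn : T' -> R)
  (hXrectn : forall t, Xrectn t = innovation A tau t (@rect01 R)) :
  ('E_Q[Xrectn] = 'E_P[Xrect] /\ 'E_P[Xrect] = 0) /\
  ('E_Q[fun t => (Xrectn t ^+ 2)%R] = 'E_P[fun t => (Xrect t ^+ 2)%R] /\
   'E_P[fun t => (Xrect t ^+ 2)%R] = (sigma_w ^+ 2)%:E).
Proof.
have n0 : (0 < n%:R :> R)%R by rewrite ltr0n.
have mX : measurable_fun setT Xrect by exact: measurable_funPT.
have [_ _ hlevy _] := hwn.
have [[d0 [T0 [P0 [X0 [_ cf f0 _]]]]] _ _ _ _] := hw.
have iX2 : P.-integrable setT (EFin \o (fun t => Xrect t ^+ 2)%R).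
  apply/integrableP; split.
    by apply/measurable_EFinP; exact: measurable_funX.
  under eq_integral do rewrite /= ger0_norm ?sqr_ge0//.
  by move: hvar; rewrite unlock => ->; rewrite ltry.
have X0' : (\int[P]_t Xrect t = 0)%R.
  by move: hmean; rewrite unlock /Rintegral => ->.
have X2' : (\int[P]_t (Xrect t ^+ 2) = sigma_w ^+ 2)%R.
  by move: hvar; rewrite unlock /Rintegral => ->.
have hX := char_fun_extended_pairing mX hw hXrect.
have momA k : [/\ Q.-integrable setT (EFin \o (fun t => A k t ^+ 2)%R),
      (\int[Q]_t A k t = 0)%R &
      (\int[Q]_t (A k t ^+ 2) = n%:R^-1 * sigma_w ^+ 2)%R].
  rewrite -X2'.
  apply: (@moments_scale_char_fun _ _ _ P _ _ Q f) => //.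
  move=> xi; have [_ _ _ ->] := hlevy k.
  by rewrite fmorphV rmorph_nat.
have [|||Wmean Wsqr] :=
  @compound_poisson_moments _ _ _ Q n%:R (n%:R^-1 * sigma_w ^+ 2)%R _ A tau
    Xrectn n0 hwn _ _ _ hXrectn.
- by move=> k; have [] := momA k.
- move=> k; have [iA2 + _] := momA k; rewrite /Rintegral => A0.
  have mA : measurable_fun setT (A k) by exact: measurable_funPT.
  have iA := integrable_of_sqr mA iA2.
  by rewrite -(fineK (integrable_fin_num measurableT iA)) A0.
- move=> k; have [iA2 _] := momA k; rewrite /Rintegral => <-.
  by rewrite fineK//; exact: (integrable_fin_num measurableT iA2).
have Wm : 'E_Q[Xrectn] = 0 by rewrite unlock.
have Ws : 'E_Q[fun t => (Xrectn t ^+ 2)%R] = (sigma_w ^+ 2)%:E.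
  by rewrite unlock Wsqr mulrA divff ?mul1r// gt_eqF.
by rewrite Wm hmean Ws hvar.
Qed.
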